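(* Let $\mathbb{P}$ be a real or complex projective space of finite dimension $\ge 2$. Consider a tiling of a closed oriented surface by quadrilateral tiles. Assume that the vertices of the tiling are colored black and white so that every edge connects vertices of different color. Associate to each black vertex a point in $\mathbb{P}$ and to each white vertex a hyperplane in $\mathbb{P}$. Assume that for each edge of the tiling, joining a vertex labeled by a point $A$ with a vertex labeled by a hyperplane $h$, the point $A$ does not lie on $h$. If all tiles but one are coherent, then the remaining tile is coherent as well.
   Context: A tiling of a closed oriented surface by quadrilateral tiles is a finite cell decomposition of the surface in which every 2-cell (tile) is a topological quadrilateral, i.e. a disk whose boundary walk consists of four edges and passes through four (marked) vertices. For distinct points $A,B$, $(AB)$ denotes the line through them. A tile whose vertices are labeled, in cyclic order, by $A,\ell,B,m$, where $A,B$ are points and $\ell,m$ are hyperplanes of $\mathbb{P}$, is called coherent if (i) neither $A$ nor $B$ is incident to either $\ell$ or $m$; and (ii) either $A=B$, or $\ell=m$, or else the line $(AB)$ and the codimension 2 subspace $\ell\cap m$ have a nonempty intersection. *)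

(* Defs.v *)
From HB Require Import structures.
From mathcomp Require Import all_boot all_order all_algebra all_fingroup.
From mathcomp Require Import reals complex.

Set Implicit Arguments.
Unset Strict Implicit.
Unset Printing Implicit Defensive.

Inductive ground := Real | Complex.

Definition scalars (R : realType) (k : ground) : fieldType :=
  match k with Real => R | Complex => R[i]%C end.

(** A projective space is given by a vector space V of dimension one more; its
    subspaces are the linear subspaces of V, so that the line through two
    distinct points A and B is A + B. *)
Section Projective.

Variables (K : fieldType) (V : vectType K).

Definition point := {U : {vspace V} | \dim U == 1}.

Definition hyperplane := {U : {vspace V} | (\dim U).+1 == \dim {:V}}.

Definition incident (A : point) (h : hyperplane) : bool :=
  (val A <= val h)%VS.

(** The arguments are the labels of a tile in cyclic order. *)
Definition coherent (A : point) (l : hyperplane) (B : point) (m : hyperplane)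
    : Prop :=
  [/\ ~~ incident A l, ~~ incident A m, ~~ incident B l & ~~ incident B m] /\
  [\/ A = B, l = m
    | exists P : point,
        (val P <= val A + val B)%VS /\ (val P <= val l :&: val m)%VS].

End Projective.

(** A finite cell decomposition of a closed oriented surface, encoded as a
    combinatorial map. A dart is an edge with a direction, i.e. a side of the
    tile lying to its left. The permutation [edge] reverses the direction, and
    [face] sends a dart to the next one on the boundary walk of its tile. The
    tiles are the orbits of [face]; the surface is obtained by gluing each side
    d to the side [edge d], reversing directions. Every such gluing of disks
    gives a closed oriented surface, and all cell decompositions without
    isolated vertices arise in this way. A tile may meet itself along edges or
    at vertices, and connectedness is not imposed. *)
Record tiling := Tiling {
  dart :> finType;
  edge : {perm dart};
  face : {perm dart};
  edgeK : involutive edge;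
  edge_neq : forall d, edge d != d;
  card_face : forall d, #|porbit face d| = 4
}.

Section Tiling.

Variable T : tiling.

(** [edge d] ends at the origin of d, hence [face (edge d)] starts there:
    the orbits of [node] are the sets of darts with a common origin. *)
Definition node : {perm T} := (edge T * face T)%g.

Definition vertex := {v : {set T} | v \in porbits node}.

Definition tile := {t : {set T} | t \in porbits (face T)}.

Definition origin (d : T) : vertex :=
  exist _ (porbit node d) (imset_f (porbit node) (erefl : d \in T)).

Definition proper_coloring (black : pred vertex) : Prop :=
  forall d : T, black (origin d) != black (origin (edge T d)).

Variables (K : fieldType) (V : vectType K) (black : pred vertex).
Variables (pt : {v | black v} -> point V).
Variables (hyp : {v | ~~ black v} -> hyperplane V).

Definition edges_nonincident : Prop :=
  forall (d : T) (a : {v | black v}) (h : {v | ~~ black v}),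
    origin d = val a -> origin (edge T d) = val h ->
    ~~ incident (pt a) (hyp h).

(** The walk may start at either black corner: [coherent] is unchanged when
    A, B and l, m are simultaneously swapped. *)
Definition coherent_tile (t : tile) : Prop :=
  exists (d : T) (a b : {v | black v}) (l m : {v | ~~ black v}),
    d \in val t /\
    [/\ origin d = val a,
        origin (face T d) = val l,
        origin (face T (face T d)) = val b
      & origin (face T (face T (face T d))) = val m] /\
    coherent (pt a) (hyp l) (pt b) (hyp m).

End Tiling.

(* Main.v *)
Require Import Defs.
From mathcomp Require Import all_boot all_order all_algebra all_fingroup.
From mathcomp Require Import reals complex.

(** Choose a spanning vector [a] for every point [A] and a linear form [f] with
    kernel [h] for every hyperplane [h].  When its four points and hyperplanes
    are pairwise non-incident, a tile A, l, B, m is coherent if and only if the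
    mixed cross-ratio
        (f_l(a) f_m(b)) / (f_l(b) f_m(a))
    equals 1 ([coherent_crossP]): if A and B are distinct, the vector
    f_l(b) a - f_l(a) b spans the intersection of the line (AB) with l, and f_m
    kills it exactly when the cross-ratio is 1.

    Give each dart from a point A to a hyperplane h the factor f_h(a), and the
    reverse dart the factor f_h(a)^-1.  The cross-ratio of a tile is then the
    product of the factors of its four sides ([prod_factor_tile]).  The product
    of these cross-ratios over all tiles runs over every dart once, and each
    edge contributes two mutually inverse factors, so it is 1
    ([prod_factor_darts]).  Hence if all tiles but one have cross-ratio 1, so
    does the last. *)

Set Implicit Arguments.
Unset Strict Implicit.
Unset Printing Implicit Defensive.

Import GRing.Theory.

(** * Coherence as an algebraic identity *)

Section Coherence.

Local Open Scope ring_scope.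

Variables (K : fieldType) (V : vectType K).
Implicit Types (A B : point V) (l m : hyperplane V).

(** Chosen from the point alone: vertices with equal labels get equal vectors,
    so the cross-ratio of a tile with [A = B] is 1 on the nose. *)
Definition spanning_vector A : V := vpick (val A).

Lemma spanning_vector_neq0 A : spanning_vector A != 0.
Proof. by rewrite vpick0 -dimv_eq0 (eqP (valP A)). Qed.

Lemma span_spanning_vector A : val A = <[spanning_vector A]>%VS.
Proof.
apply/esym/eqP; rewrite eqEdim -memvE memv_pick dim_vline.
by rewrite spanning_vector_neq0 (eqP (valP A)).
Qed.

Definition hyperplane_basis l : (\dim (val l)).+1.-tuple V :=
  [tuple of vpick (val l)^C :: vbasis (val l)].

Lemma hyperplane_basisP l : basis_of fullv (hyperplane_basis l).
Proof.
have dimC : \dim (val l)^C = 1%N.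
  by rewrite dimv_compl -[X in (X - _)%N](eqP (valP l)) subSnn.
have c_neq0 : vpick (val l)^C != 0 by rewrite vpick0 -dimv_eq0 dimC.
rewrite basisEfree subvf /= size_tuple (eqP (valP l)) /= leqnn !andbT free_cons.
rewrite (basis_free (vbasisP _)) andbT (span_basis (vbasisP _)).
apply: contraNN c_neq0 => c_in_l.
by rewrite -memv0 -(capv_compl (val l)) memv_cap c_in_l memv_pick.
Qed.

(** The coordinate along a vector outside [l], in a basis whose other members
    span [l]; it depends on [l] alone, so that equal hyperplanes at different
    vertices receive the same form. *)
Definition linear_form l (v : V) : K :=
  coord (hyperplane_basis l) ord0 v.

Lemma linear_formD l u v :
  linear_form l (u + v) = linear_form l u + linear_form l v.
Proof. exact: linearD. Qed.

Lemma linear_formZ l x v : linear_form l (x *: v) = x * linear_form l v.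
Proof. exact: linearZ. Qed.

Lemma linear_form_eq0 l v : (linear_form l v == 0) = (v \in val l).
Proof.
have basis_l := hyperplane_basisP l.
have basis_lift i : (hyperplane_basis l)`_(lift ord0 i) = (vbasis (val l))`_i.
  by [].
apply/eqP/idP => [fv0 | v_l].
  rewrite (coord_basis basis_l (memvf v)) big_ord_recl.
  rewrite [coord _ _ _]fv0 scale0r add0r.
  apply: memv_suml => i _; apply: memvZ; rewrite basis_lift.
  by apply: vbasis_mem; rewrite mem_nth // size_tuple.
rewrite /linear_form (coord_vbasis v_l) linear_sum big1 // => i _.
have fi0 : coord (hyperplane_basis l) ord0 (vbasis (val l))`_i = 0.
  by rewrite -basis_lift coord_free // (basis_free basis_l).
by rewrite linearZ /= fi0 mulr0.
Qed.

Definition pairing l A : K := linear_form l (spanning_vector A).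

Lemma pairing_eq0 l A : (pairing l A == 0) = incident A l.
Proof. by rewrite linear_form_eq0 /incident memvE -span_spanning_vector. Qed.

(** Two linear equations in the coefficients of a vector on the line (AB) have
    a nonzero solution if and only if their determinant vanishes. *)
Lemma coherent_crossP A l B m :
    [/\ ~~ incident A l, ~~ incident A m, ~~ incident B l & ~~ incident B m] ->
  coherent A l B m <-> pairing l A * pairing m B = pairing l B * pairing m A.
Proof.
move=> inc; split=> [[_ [-> | -> | [P [P_AB P_lm]]]] | cross].
- by [].
- by rewrite mulrC.
- have [fAl fAm fBl fBm] := inc.
  move: P_AB P_lm; rewrite !span_spanning_vector -!memvE memv_cap.
  case/memv_addP=> _ /vlineP[x ->] [_ /vlineP[y ->] Pxy] /andP[].
  rewrite -!linear_form_eq0 Pxy !linear_formD !linear_formZ -!/(pairing _ _).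
  move=> /eqP eq_l /eqP eq_m.
  (* If x = 0, the first equation also gives y = 0, and P would be zero. *)
  have x_neq0 : x != 0.
    apply: contraTneq (spanning_vector_neq0 P) => x0.
    move: eq_l; rewrite Pxy x0 mul0r add0r => /eqP.
    rewrite mulf_eq0 pairing_eq0 (negPf fBl) orbF => /eqP->.
    by rewrite !scale0r addr0 eqxx.
  have xl : x * pairing l A = - (y * pairing l B).
    by apply/eqP; rewrite -addr_eq0 eq_l.
  have xm : x * pairing m A = - (y * pairing m B).
    by apply/eqP; rewrite -addr_eq0 eq_m.
  apply: (mulfI x_neq0).
  by rewrite mulrA xl [RHS]mulrCA xm mulrN mulNr -mulrA mulrCA.
split=> //.
have [-> | A_neq_B] := eqVneq A B; first exact: Or31.
have [fAl fAm fBl fBm] := inc.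
(* By construction p lies on both (AB) and l; the identity puts it on m. *)
pose p := pairing l B *: spanning_vector A - pairing l A *: spanning_vector B.
have p_neq0 : p != 0.
  apply: contraNneq A_neq_B => /eqP; rewrite subr_eq0 => /eqP ab.
  apply/eqP/val_inj/eqP; rewrite eqEdim (eqP (valP A)) (eqP (valP B)) leqnn.
  rewrite andbT span_spanning_vector -memvE.
  rewrite (span_spanning_vector B); apply/vlineP.
  exists ((pairing l B)^-1 * pairing l A).
  by rewrite -scalerA -ab scalerK ?pairing_eq0.
have dim_p : \dim <[p]>%VS == 1%N by rewrite dim_vline p_neq0.
apply: Or33; exists (exist _ <[p]>%VS dim_p) => /=.
rewrite -!memvE memv_cap -!linear_form_eq0 /p -scaleNr !linear_formD.
rewrite !linear_formZ -!/(pairing _ _) !mulNr !subr_eq0 cross eqxx mulrC eqxx.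
by split=> //; rewrite !span_spanning_vector memv_add ?memvZ ?memv_line.
Qed.

End Coherence.

(** * Multiplying over the tiling *)

(** The dart [edge d] starts where [d] ends, which is where the next side of the
    tile starts. *)
Lemma origin_edge (T : tiling) (d : T) : origin (edge T d) = origin (face T d).
Proof.
apply/val_inj/eqP; rewrite /= eq_sym eq_porbit_mem.
have -> : face T d = node T (edge T d) by rewrite permM edgeK.
by rewrite (mem_porbit _ 1).
Qed.

Lemma face4 (T : tiling) (d : T) :
  face T (face T (face T (face T d))) = d.
Proof. by have := iter_porbit (face T) d; rewrite card_face. Qed.

Lemma porbit_face_big (T : tiling) (S : comPzSemiRingType) (F : T -> S)
    (d : T) :
  (\prod_(e in porbit (face T) d) F e
  = F d * F (face T d) * F (face T (face T d))
    * F (face T (face T (face T d))))%R.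
Proof.
have uniq_d := uniq_traject_porbit (face T) d.
have mem_d := porbit_traject (face T) d.
rewrite card_face in uniq_d mem_d.
by rewrite (eq_bigl _ _ mem_d) -big_uniq //= !big_cons big_nil mulr1 !mulrA.
Qed.

Section Factors.

Local Open Scope ring_scope.

Variables (T : tiling) (K : fieldType) (V : vectType K).
Variables (black : pred (vertex T)).
Variables (pt : {v | black v} -> point V).
Variables (hyp : {v | ~~ black v} -> hyperplane V).
Hypothesis coloring : proper_coloring black.
Hypothesis nonincident : edges_nonincident pt hyp.

(** The value [1] is a placeholder for pairs of vertices that are not a black
    one followed by a white one. *)
Definition vertex_pairing (u v : vertex T) : K :=
  if (insub u, insub v) is (Some a, Some h) then pairing (hyp h) (pt a) else 1.

Lemma vertex_pairingE (a : {v | black v}) (h : {v | ~~ black v}) :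
  vertex_pairing (val a) (val h) = pairing (hyp h) (pt a).
Proof. by rewrite /vertex_pairing !valK. Qed.

Definition dart_pairing (d : T) : K :=
  vertex_pairing (origin d) (origin (edge T d)).

Definition factor (d : T) : K :=
  if black (origin d) then dart_pairing d else (dart_pairing (edge T d))^-1.

Lemma black_face (d : T) : black (origin (face T d)) = ~~ black (origin d).
Proof.
rewrite -origin_edge; have := coloring d.
by case: (black _); case: (black _).
Qed.

Lemma dart_pairing_neq0 (d : T) : black (origin d) -> dart_pairing d != 0.
Proof.
move=> black_d; have white_ed : ~~ black (origin (edge T d)).
  by rewrite origin_edge black_face black_d.
pose a : {v | black v} := Sub (origin d) black_d.
pose h : {v | ~~ black v} := Sub (origin (edge T d)) white_ed.
rewrite /dart_pairing -[origin d]/(val a) -[origin (edge T d)]/(val h).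
by rewrite vertex_pairingE pairing_eq0; apply: nonincident.
Qed.

(** Pairing each black-to-white dart with its reverse cancels all factors.  The
    darts are first separated by colour: grouping by edges without this only
    shows that the square of the product is 1. *)
Lemma prod_factor_darts : \prod_(d : T) factor d = 1.
Proof.
rewrite (bigID (fun d => black (origin d))) /=.
rewrite [X in _ * X](reindex_inj (@perm_inj _ (edge T))) /=.
under [X in _ * X]eq_bigl => d do rewrite origin_edge black_face negbK.
rewrite -big_split big1 //= => d black_d.
rewrite /factor black_d origin_edge black_face black_d /= edgeK.
by rewrite divff ?dart_pairing_neq0.
Qed.

(** The tiles partition the darts. *)
Lemma prod_factor_tiles :
  \prod_(t in porbits (face T)) \prod_(d in t) factor d = 1.
Proof.
rewrite -[RHS]prod_factor_darts.
rewrite (partition_big (porbit (face T)) (mem (porbits (face T)))) /=;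
  last by move=> d _; apply: imset_f.
apply: eq_bigr => _ /imsetP[d _ ->]; apply: eq_bigl => e.
by rewrite eq_porbit_mem porbit_sym.
Qed.

Section Corners.

Variables (d : T) (a b : {v | black v}) (l m : {v | ~~ black v}).
Hypothesis origin0 : origin d = val a.
Hypothesis origin1 : origin (face T d) = val l.
Hypothesis origin2 : origin (face T (face T d)) = val b.
Hypothesis origin3 : origin (face T (face T (face T d))) = val m.

Lemma corners_nonincident :
  [/\ ~~ incident (pt a) (hyp l), ~~ incident (pt a) (hyp m),
      ~~ incident (pt b) (hyp l) & ~~ incident (pt b) (hyp m)].
Proof.
split.
- by apply: (nonincident (d := d)); rewrite ?origin_edge.
- apply: (nonincident (d := edge T (face T (face T (face T d))))).
    by rewrite origin_edge face4.
  by rewrite edgeK.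
- by apply: (nonincident (d := edge T (face T d))); rewrite ?edgeK ?origin_edge.
- by apply: (nonincident (d := face T (face T d))); rewrite ?origin_edge.
Qed.

(** The four sides go A to l, l to B, B to m and m to A, so their factors are
    alternately values of the forms and inverses of such values. *)
Lemma prod_factor_tile :
  \prod_(e in porbit (face T) d) factor e
  = (pairing (hyp l) (pt a) * pairing (hyp m) (pt b))
    / (pairing (hyp l) (pt b) * pairing (hyp m) (pt a)).
Proof.
rewrite porbit_face_big /factor /dart_pairing !edgeK !origin_edge face4.
rewrite origin0 origin1 origin2 origin3 !vertex_pairingE.
rewrite (valP a) (valP b) (negPf (valP l)) (negPf (valP m)).
by rewrite -mulrA mulf_div.
Qed.

Lemma coherent_prod_factor :
  coherent (pt a) (hyp l) (pt b) (hyp m)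
  <-> \prod_(e in porbit (face T) d) factor e = 1.
Proof.
have inc := corners_nonincident; have [_ fma flb _] := inc.
rewrite (coherent_crossP inc) prod_factor_tile.
rewrite -!pairing_eq0 in fma flb.
by split=> [-> | /divr1_eq //]; rewrite divff // mulf_neq0.
Qed.

End Corners.

(** The product of the factors is taken over an unordered orbit, so it does not
    see at which black corner the walk around the tile starts. *)
Lemma coherent_tileP (t : tile T) :
  coherent_tile pt hyp t <-> \prod_(e in val t) factor e = 1.
Proof.
split=> [[d [a [b [l [m [d_t [[o0 o1 o2 o3] coh]]]]]]] | prod1].
  have /imsetP[e _ t_e] := valP t.
  have -> : val t = porbit (face T) d.
    by rewrite t_e; apply/eqP; rewrite eq_porbit_mem porbit_sym -t_e.
  exact/(coherent_prod_factor o0 o1 o2 o3).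
have [d t_d black_d] : exists2 d, val t = porbit (face T) d & black (origin d).
  have /imsetP[d _ t_d] := valP t.
  have [black_d | white_d] := boolP (black (origin d)); first by exists d.
  exists (face T d); last by rewrite black_face.
  by rewrite t_d; apply/eqP; rewrite eq_porbit_mem porbit_sym (mem_porbit _ 1).
have white1 : ~~ black (origin (face T d)) by rewrite black_face black_d.
have black2 : black (origin (face T (face T d))) by rewrite black_face.
have white3 : ~~ black (origin (face T (face T (face T d)))).
  by rewrite black_face black2.
exists d, (Sub (origin d) black_d), (Sub (origin _) black2).
exists (Sub (origin _) white1), (Sub (origin _) white3).
rewrite t_d in prod1 *; split; [exact: porbit_id | split; first by []].
by apply: (proj2 (coherent_prod_factor (d := d) _ _ _ _)).
Qed.

End Factors.

Theorem theorem2p6 (R : realType) (k : ground) (n : nat)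
    (V : vectType (scalars R k)) (hn : 2 <= n) (hV : \dim {:V} = n.+1)
    (T : tiling) (black : pred (vertex T))
    (pt : {v : vertex T | black v} -> point V)
    (hyp : {v : vertex T | ~~ black v} -> hyperplane V)
    (hcol : proper_coloring black)
    (hinc : edges_nonincident pt hyp)
    (t0 : tile T)
    (hcoh : forall t : tile T, t <> t0 -> coherent_tile pt hyp t) :
  coherent_tile pt hyp t0.
Proof.
apply/(coherent_tileP hcol hinc).
have := prod_factor_tiles hcol hinc.
rewrite (bigD1 (val t0) (valP t0)) /= => prod1; rewrite -[RHS]prod1.
rewrite [X in (_ * X)%R]big1 ?mulr1 // => t /andP[t_tile t_neq].
apply/(coherent_tileP hcol hinc (exist _ t t_tile))/hcoh => t_t0.
by rewrite -t_t0 eqxx in t_neq.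
Qed.
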